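(* Let $\Gamma$ and $\Delta$ be graphs. Suppose that there are constants $A\geq 1$, $B\geq 0$, a sequence $\rho=(\rho_j)_{j\in\mathbb{N}}$ of positive integers with $\rho_j\to\infty$, and a sequence of $(A\rho+B)$-surjective $(A,B)$-quasi-$\rho$-homotheties $\iota_j\colon\Delta\to\Gamma$ ($j\in\mathbb{N}$). Then $\operatorname{sCop}(\Gamma)=\operatorname{wCop}(\Delta)$.
   Context: Quasi-homotheties. Let $A\geq 1$, $B\geq 0$, $\rho=(\rho_j)_j$ a sequence of positive integers with $\rho_j\to\infty$, and $\Gamma$, $\Delta_j$ ($j\in\mathbb{N}$) graphs. A collection of maps $\iota_j\colon\Delta_j\to\Gamma$ (between vertex sets) is a sequence of $(A\rho+B)$-surjective $(A,B)$-quasi-$\rho$-homotheties if for all $j\in\mathbb{N}$: (1) for every $x\in\Gamma$ there is $\overline{x}\in\Delta_j$ with $d_\Gamma(\iota_j(\overline{x}),x)\leq A\rho_j+B$; (2) for all $\overline{x},\overline{y}\in\Delta_j$, $A^{-1}d_{\Delta_j}(\overline{x},\overline{y})-B\leq\frac{1}{\rho_j}d_\Gamma(\iota_j(\overline{x}),\iota_j(\overline{y}))\leq A\,d_{\Delta_j}(\overline{x},\overline{y})+B$. In the claim all $\Delta_j$ are equal to $\Delta$. Convention: $\mathbb{N}=\mathbb{Z}_{\geq 1}$. Graphs are connected, undirected, without double edges or loops, with the path metric on vertices. Game. Let $\Gamma$ be a graph. The cops and robbers game on $\Gamma$ has parameters: number of cops $n\in\mathbb{N}$, base point (treasure) $v\in\Gamma$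 a vertex, cop speed $\sigma\in\mathbb{N}$, robber speed $\psi\in\mathbb{N}$, cop reach $\rho\in\mathbb{N}$, robber radius $R\in\mathbb{N}$. It is a two-player game with perfect information. First the cop player chooses $n$ vertices as starting positions of the cops, then the robber chooses a vertex as starting position. The players then alternate turns, starting with the cops. In each turn the cop player may move each cop along a path of length at most $\sigma$ to some vertex; then the robber moves along a path of length at most $\psi$ ending in a vertex. One cop move followed by one robber move is a stage. The cop player wins if the robber is captured, i.e. at some time during some stage the robber's position is at distance at most $\rho$ from some cop's position (this includes every vertex traversed by the robber during a move: the robber must traverse the path edge by edge without ever coming within distance $\rho$ of a cop), or if the cops eventually defend $v$, i.e. after some finite initial time the robber never enters the closed ball of radius $R$ around $v$. Otherwise the robber wins. The weak cop number $\operatorname{wCop}(\Gamma)\in\mathbb{N}\cup\{\infty\}$ is the infimum (with $\inf\emptyset=\infty$) of all $n\in\mathbb{N}$ such that $\forall v\in\Gamma,\ \exists\sigma\in\mathbb{N},\ \exists\rho\in\mathbb{N},\ \forall\psi\in\mathbb{N},\ \forall R\in\mathbb{N}$: the cop player has a winning strategy with $n$ cops. The strong cop number $\operatorname{sCop}(\Gamma)$ is defined in the same way with the quantifiers $\forall v\in\Gamma,\ \exists\sigma\in\mathbb{N},\ \forall\psi\in\mathbb{N},\ \exists\rho\in\mathbb{N},\ \forall R\in\mathbb{N}$. *)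

(* Defs.v *)
From HB Require Import structures.
From mathcomp Require Import all_boot all_order all_algebra.
From mathcomp Require Import all_classical all_reals all_analysis.

Set Implicit Arguments.
Unset Strict Implicit.
Unset Printing Implicit Defensive.

Import Order.TTheory GRing.Theory Num.Theory.
Import numFieldNormedType.Exports.

Local Open Scope classical_set_scope.
Local Open Scope ring_scope.

(* Throughout, the set of positive integers is rendered by nat together with
   explicit hypotheses 0 < n; sequences are indexed by nat, starting at 0. *)

(* The vertex set is an arbitrary type, possibly infinite, and vertices may
   have infinite degree. *)
Record graph := Graph {
  vertex :> Type;
  adj : rel vertex;
  adj_sym : symmetric adj;
  adj_irrefl : irreflexive adj;
  adj_connected : forall x y : vertex, exists p, path adj x p /\ last x p = y }.

Section Distance.
Context {G : graph}.
Implicit Types x y : G.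

(* A path x :: p has size p edges. *)
Definition joined x y : pred nat := fun l =>
  `[< exists p, [/\ path (@adj G) x p, last x p = y & size p = l] >].

Lemma joined_ex x y : exists l, joined x y l.
Proof.
by have [p [xp py]] := adj_connected x y; exists (size p); apply/asboolP; exists p.
Qed.

Definition dist x y : nat := ex_minn (joined_ex x y).

End Distance.

Section Trajectories.
Context {G : graph}.

(* A trajectory consists of a starting vertex x and a sequence m of moves, the
   move m i made in stage i being the list of the vertices that are
   successively reached (the empty list if the player stays put). *)
Fixpoint position (x : G) (m : nat -> seq G) (i : nat) : G :=
  if i is i'.+1 then last (position x m i') (m i') else x.

Definition traversed (x : G) (m : nat -> seq G) (i : nat) : seq G :=
  position x m i :: m i.

Definition legal (speed : nat) (x : G) (m : nat -> seq G) : Prop :=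
  forall i, path (@adj G) (position x m i) (m i) /\ (size (m i) <= speed)%N.

End Trajectories.

Section Game.
Context {G : graph}.

(* The cops choose their starting vertices before the robber does. Afterwards
   their moves depend on the robber's start and on the list of all the previous
   moves of the robber; the cops' own previous moves are determined by these. *)
Record cop_strategy (n : nat) := CopStrategy {
  cop_start : 'I_n -> G;
  cop_reply : G -> seq (seq G) -> 'I_n -> seq G }.

Definition cop_moves n (S : cop_strategy n) (r : G) (m : nat -> seq G)
    (k : 'I_n) : nat -> seq G :=
  fun i => cop_reply S r (mkseq m i) k.

(* In stage i the cops move while the robber is at position r m i; then the
   robber moves while cop k is at its position at the start of stage i.+1. *)
Definition captured n (S : cop_strategy n) (reach : nat) (r : G)
    (m : nat -> seq G) : Prop :=
  exists (i : nat) (k : 'I_n),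
    has (fun c => dist (position r m i) c <= reach)%N
        (traversed (cop_start S k) (cop_moves S r m k) i)
    \/ has (fun x =>
              dist x (position (cop_start S k) (cop_moves S r m k) i.+1)
                <= reach)%N
           (traversed r m i).

Definition defended (v : G) (radius : nat) (r : G) (m : nat -> seq G) : Prop :=
  exists N, forall i, (N <= i)%N ->
    all (fun x => radius < dist v x)%N (traversed r m i).

Definition winning n (S : cop_strategy n) (v : G)
    (sigma psi reach radius : nat) : Prop :=
  forall (r : G) (m : nat -> seq G), legal psi r m ->
    (forall k, legal sigma (cop_start S k) (cop_moves S r m k))
    /\ (captured S reach r m \/ defended v radius r m).

Definition cops_win (n : nat) (v : G) (sigma psi reach radius : nat) : Prop :=
  exists S : cop_strategy n, winning S v sigma psi reach radius.

End Game.

Definition weak_cops_win (G : graph) (n : nat) : Prop :=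
  forall v : G,
  exists sigma, (0 < sigma)%N /\
  exists reach, (0 < reach)%N /\
  forall psi, (0 < psi)%N ->
  forall radius, (0 < radius)%N ->
  cops_win n v sigma psi reach radius.

Definition strong_cops_win (G : graph) (n : nat) : Prop :=
  forall v : G,
  exists sigma, (0 < sigma)%N /\
  forall psi, (0 < psi)%N ->
  exists reach, (0 < reach)%N /\
  forall radius, (0 < radius)%N ->
  cops_win n v sigma psi reach radius.

(* Cop numbers are taken in the extended reals, where ereal_inf set0 = +oo. *)
Definition wCop (R : realType) (G : graph) : \bar R :=
  ereal_inf [set n%:R%:E | n in [set n : nat | (0 < n)%N /\ weak_cops_win G n]].

Definition sCop (R : realType) (G : graph) : \bar R :=
  ereal_inf [set n%:R%:E | n in [set n : nat | (0 < n)%N /\ strong_cops_win G n]].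

Definition surjective_quasi_homotheties (R : realType) (A B : R)
    (rho : nat -> nat) (G : graph) (D : nat -> graph)
    (iota : forall j, D j -> G) : Prop :=
  forall j,
    (forall x : G, exists y : D j,
       (dist (iota j y) x)%:R <= A * (rho j)%:R + B)
    /\ (forall x y : D j,
       A^-1 * (dist x y)%:R - B
         <= (rho j)%:R^-1 * (dist (iota j x) (iota j y))%:R
         <= A * (dist x y)%:R + B).

(* Main.v *)
Require Import Defs.
From mathcomp Require Import all_boot all_order all_algebra.
From mathcomp Require Import all_classical all_reals all_analysis.
From mathcomp Require Import zify lra.

Set Implicit Arguments.
Unset Strict Implicit.
Unset Printing Implicit Defensive.

Import Order.TTheory GRing.Theory Num.Theory.
Import numFieldNormedType.Exports.

Local Open Scope classical_set_scope.
Local Open Scope ring_scope.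

(** Both cop numbers are infima over sets of [n], and these two sets coincide.
   Each inclusion transports a winning strategy from one graph to the other by
   simulation: the cops in the real game on [X] run in their head a game on
   another graph [Y], in which the robber's position is replaced by its image
   under a map [f : X -> Y], and they copy the simulated cops' positions to [X]
   by a map [g : Y -> X].  One real stage is worth [T] simulated stages, so the
   image of a robber move is cut into [T] shorter moves.  As the simulated
   cops answer these moves one by one while the real cops move all at once, the
   real cops lag behind by one block of [T] stages; a cop moves at most [s * T]
   during a block, and enlarging the reach by that much compensates the delay
   ([cops_win_simulation]).

   One homothety alone, being a quasi-isometry, transports a strategy for the
   weak game on [Delta] to the game on [Gamma], with [T = 1]
   ([weak_to_strong]).

   In the other direction the whole sequence is used, with [T] equal to the
   scale [h = rho j] ([strong_to_weak]).  An edge of [Delta] is stretched to a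
   path of length of the order of [h], which takes [h] stages to walk at a speed
   that does not depend on [h].  So the real robber speed alone determines the
   simulated one, hence also the simulated reach [r]; and only then does [j]
   have to be chosen, so large that [r <= h].  Distances in [Gamma] of the order
   of [h], among them [r] and the distance [s * h] that a cop covers in a block,
   are bounded distances in [Delta].  The real speed and reach of the cops are
   therefore bounded independently of the robber's speed, and this is what the
   weak game asks for. *)

(** * The path metric *)

Section Metric.
Context {G : graph}.
Implicit Types (x y z : G) (p : seq G).

Lemma dist_last x p : path (@adj G) x p -> (dist x (last x p) <= size p)%N.
Proof.
move=> xp; rewrite /dist; case: ex_minnP => l _; apply.
by apply/asboolP; exists p.
Qed.

Lemma geodesic_ex x y :
  exists p, [/\ path (@adj G) x p, last x p = y & size p = dist x y].
Proof. by rewrite /dist; case: ex_minnP => l /asboolP. Qed.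

Definition geodesic x y : seq G := projT1 (cid (geodesic_ex x y)).

Lemma geodesicP x y : [/\ path (@adj G) x (geodesic x y),
  last x (geodesic x y) = y & size (geodesic x y) = dist x y].
Proof. by rewrite /geodesic; case: cid. Qed.

Lemma distxx x : dist x x = 0%N.
Proof. by apply/eqP; rewrite -leqn0 (@dist_last x [::]). Qed.

Lemma dist_triangle y x z : (dist x z <= dist x y + dist y z)%N.
Proof.
have [p1 l1 <-] := geodesicP x y; have [p2 l2 <-] := geodesicP y z.
rewrite -size_cat -{1}l2 -{1}l1 -last_cat; apply: dist_last.
by rewrite cat_path p1 l1.
Qed.

Lemma dist_sym x y : dist x y = dist y x.
Proof.
suff le_dist (u v : G) : (dist v u <= dist u v)%N.
  by apply/eqP; rewrite eqn_leq !le_dist.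
have [p1 l1 <-] := geodesicP u v; set p := geodesic u v in p1 l1 *.
have: path (@adj G) (last u p) (rev (belast u p)).
  by rewrite rev_path; apply: sub_path p1 => a b; rewrite adj_sym.
move=> /dist_last; rewrite size_rev size_belast l1; congr (dist v _ <= _)%N.
by case: p {p1} l1 => /= [->|a p _] //; rewrite rev_cons last_rcons.
Qed.

Lemma dist_adj x y : adj x y -> (dist x y <= 1)%N.
Proof. by move=> xy; apply: (@dist_last x [:: y]); rewrite /= xy. Qed.

(** The vertices of a path are addressed by the number of edges walked, since
   vertices carry no decidable equality. *)
Lemma has_pathP (a : pred G) x p :
  reflect (exists2 k, (k <= size p)%N & a (last x (take k p))) (has a (x :: p)).
Proof.
apply: (iffP idP) => /=.
  elim: p x => [|y p IHp] x /=; first by rewrite orbF => ax; exists 0%N.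
  case/orP=> [ax|/IHp [k lek ak]]; first by exists 0%N.
  by exists k.+1.
case=> k; elim: p x k => [|y p IHp] x [|k] //= le ak; rewrite ?ak //.
by rewrite (IHp y k) ?orbT.
Qed.

Lemma dist_on_path x p k : path (@adj G) x p ->
  (dist x (last x (take k p)) <= size p)%N.
Proof.
move=> xp; apply: leq_trans (dist_last (take_path k xp)) _.
by rewrite size_take_min geq_minr.
Qed.

Lemma dist_on_geodesic x y k :
  (dist x (last x (take k (geodesic x y))) <= dist x y)%N.
Proof. by have [p _ <-] := geodesicP x y; apply: dist_on_path. Qed.

Lemma dist_position speed x m i t : legal speed x m ->
  (dist (position x m i) (position x m (i + t)) <= speed * t)%N.
Proof.
move=> lm; elim: t => [|t IHt]; first by rewrite addn0 distxx.
have [pm sm] := lm (i + t)%N; rewrite addnS mulnSr /=.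
apply: leq_trans (dist_triangle (position x m (i + t)) _ _) _.
by apply: leq_add => //; apply: leq_trans (dist_last pm) sm.
Qed.

Lemma positionS x m i : position x m i.+1 = last (position x m i) (m i).
Proof. by []. Qed.

Lemma eq_position x m m' i : (forall j, (j < i)%N -> m j = m' j) ->
  position x m i = position x m' i.
Proof.
elim: i => //= i IHi mm'; rewrite mm' // IHi // => j ji.
by apply: mm'; apply: ltnW.
Qed.

End Metric.

(** * Simulating a game on another graph *)

Lemma piece_index p T q : (0 < p)%N -> (0 < T)%N -> (q <= p * T)%N ->
  exists t a, [/\ (t < T)%N, (a <= p)%N & q = (p * t + a)%N].
Proof.
(* A positive multiple of [p] is counted as the end of a piece rather than as
   the start of the next one: there is no next one after the last. *)
move=> p_gt0 T_gt0; case: q => [|q] qpT.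
  by exists 0%N, 0%N; rewrite muln0.
exists (q %/ p)%N, (q %% p).+1; rewrite ltn_mod p_gt0; split => //.
  by rewrite ltn_divLR // mulnC.
by rewrite addnS mulnC -divn_eq.
Qed.

Section Simulation.
Context {X Y : graph}.
Variables (f : X -> Y) (g : Y -> X) (T p : nat).
Hypotheses (T_gt0 : (0 < T)%N) (p_gt0 : (0 < p)%N).

Fixpoint image_path (x : X) (l : seq X) : seq Y :=
  if l is y :: l' then geodesic (f x) (f y) ++ image_path y l' else [::].

Lemma image_pathP x l : path (@adj Y) (f x) (image_path x l)
  /\ last (f x) (image_path x l) = f (last x l).
Proof.
elim: l x => //= y l IHl x; have [p1 l1 _] := geodesicP (f x) (f y).
by rewrite cat_path last_cat p1 l1; apply: IHl.
Qed.

Lemma image_path_vertex x l k : exists k',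
  last (f x) (take k' (image_path x l)) = f (last x (take k l)).
Proof.
elim: l x k => [|y l IHl] x [|k] /=; try by exists 0%N; rewrite ?take0.
have [k' Hk'] := IHl y k; have [_ l1 _] := geodesicP (f x) (f y).
exists (size (geodesic (f x) (f y)) + k')%N.
by rewrite takeD take_size_cat // drop_size_cat // last_cat l1.
Qed.

(** Stage [i] of the simulated game belongs to the block of number [i %/ T],
   which is worth one real stage.  The image of a real move can be longer than
   the simulated speed [p], and is therefore walked in [T] pieces; if it is
   short, the last pieces are empty and the simulated robber waits. *)
Definition shadow (r : X) (m : nat -> seq X) (i : nat) : seq Y :=
  let b := (i %/ T)%N in
  take p (drop (p * (i %% T)) (image_path (position r m b) (m b))).

Lemma shadow_block r m b t : (t < T)%N -> shadow r m (b * T + t) =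
  take p (drop (p * t) (image_path (position r m b) (m b))).
Proof.
move=> tT; rewrite /shadow divnMDl // divn_small // addn0.
by rewrite modnMDl modn_small.
Qed.

Lemma eq_shadow r m m' b i : (forall j, (j < b)%N -> m j = m' j) ->
  (i < b * T)%N -> shadow r m i = shadow r m' i.
Proof.
move=> mm'; rewrite -ltn_divLR // => ib; rewrite /shadow mm' //.
by rewrite (@eq_position _ r m m') // => j ji; apply/mm'/(ltn_trans ji).
Qed.

Section Stretch.
Variable L : nat.
Hypothesis stretch : forall x y, adj x y -> (dist (f x) (f y) <= L)%N.

Lemma size_image_path x l : path (@adj X) x l ->
  (size (image_path x l) <= L * size l)%N.
Proof.
elim: l x => //= y l IHl x /andP[xy yl].
rewrite size_cat mulnS leq_add ?IHl //.
by have [_ _ ->] := geodesicP (f x) (f y); apply: stretch.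
Qed.

Lemma image_path_near x l k : path (@adj X) x l ->
  exists2 k', (k' <= size l)%N
    & (dist (f (last x (take k' l))) (last (f x) (take k (image_path x l)))
        <= L)%N.
Proof.
elim: l x k => [|y l IHl] x k /=; first by exists 0%N => //; rewrite distxx.
move=> /andP[xy yl]; have [_ l1 _] := geodesicP (f x) (f y).
rewrite take_cat; case: ltnP => Hk.
  exists 0%N => //=; apply: leq_trans (dist_on_geodesic _ _ _) _.
  exact: stretch.
have [k' le Hk'] := IHl y (k - size (geodesic (f x) (f y)))%N yl.
by exists k'.+1 => //; rewrite last_cat l1.
Qed.

Variables (psi : nat) (r : X) (m : nat -> seq X).
Hypotheses (legal_m : legal psi r m) (pace : (L * psi <= p * T)%N).

Lemma size_image_move b :
  (size (image_path (position r m b) (m b)) <= p * T)%N.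
Proof.
have [pm sm] := legal_m b; apply: leq_trans (size_image_path pm) _.
by apply: leq_trans pace; rewrite leq_mul2l sm orbT.
Qed.

Lemma position_shadow_block b t : (t <= T)%N ->
  position (f r) (shadow r m) (b * T) = f (position r m b) ->
  position (f r) (shadow r m) (b * T + t) =
  last (f (position r m b)) (take (p * t) (image_path (position r m b) (m b))).
Proof.
move=> + Hb; elim: t => [|t IHt] tT; first by rewrite addn0 muln0 take0.
by rewrite addnS /= IHt 1?ltnW // shadow_block // -last_cat -takeD mulnSr.
Qed.

Lemma position_shadow b :
  position (f r) (shadow r m) (b * T) = f (position r m b).
Proof.
elim: b => // b IHb; rewrite mulSnr (position_shadow_block (leqnn T) IHb) /=.
rewrite take_oversize ?size_image_move //.
by have [] := image_pathP (position r m b) (m b).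
Qed.

Lemma legal_shadow : legal p (f r) (shadow r m).
Proof.
move=> i; rewrite (divn_eq i T); set b := (i %/ T)%N; set t := (i %% T)%N.
have tT : (t < T)%N by rewrite ltn_mod.
rewrite (position_shadow_block (ltnW tT) (position_shadow b)) shadow_block //.
split; last by rewrite size_take_min geq_minl.
apply: take_path; have [+ _] := image_pathP (position r m b) (m b).
by rewrite -{1}(cat_take_drop (p * t) (image_path _ _)) cat_path => /andP[].
Qed.

Lemma shadow_vertex b t k : (t < T)%N -> exists q,
  last (position (f r) (shadow r m) (b * T + t))
       (take k (shadow r m (b * T + t))) =
  last (f (position r m b)) (take q (image_path (position r m b) (m b))).
Proof.
move=> tT; exists (p * t + minn k p)%N.
rewrite (position_shadow_block (ltnW tT) (position_shadow b)) shadow_block //.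
by rewrite -last_cat -take_min takeD.
Qed.

(** Nothing of the image of a move is lost in the cutting, so a ball that the
   simulated robber avoids is avoided by the images of all the vertices that the
   real robber visits. *)
Lemma image_vertex_shadow b q : exists t k, (t < T)%N /\
  last (f (position r m b)) (take q (image_path (position r m b) (m b))) =
  last (position (f r) (shadow r m) (b * T + t))
       (take k (shadow r m (b * T + t))).
Proof.
wlog qpT : q / (q <= p * T)%N => [wq|].
  case: (leqP q (p * T)%N) => [|qpT]; first exact: wq.
  have [t [k [tT E]]] := wq _ (leqnn (p * T)%N); exists t, k; split => //.
  have lenP := size_image_move b.
  rewrite -E (take_oversize lenP) take_oversize //.
  exact: leq_trans lenP (ltnW qpT).
have [t [a [tT ap qE]]] := piece_index p_gt0 T_gt0 qpT.
exists t, a; split => //.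
rewrite (position_shadow_block (ltnW tT) (position_shadow b)) shadow_block //.
by rewrite -last_cat -take_min (minn_idPl ap) -takeD -qE.
Qed.

End Stretch.

Section Strategy.
Variables (n : nat) (S : cop_strategy (G := Y) n).

Definition block_start (r : X) (m : nat -> seq X) (k : 'I_n) (b : nat) : Y :=
  position (cop_start S k) (cop_moves S (f r) (shadow r m) k) (b * T).

(** In stage [b] the robber's moves before [b] are known, which is just enough
   to play the first [b] blocks of the simulated game; the real cops move to the
   image of the outcome.  The predecessor of [0] being [0], they stay put in
   stage [0]. *)
Definition simulation : cop_strategy (G := X) n := CopStrategy
  (fun k => g (cop_start S k))
  (fun r h k => let m := nth [::] h in
     geodesic (g (block_start r m k (size h).-1))
              (g (block_start r m k (size h)))).

Lemma eq_block_start r m m' k b : (forall j, (j < b)%N -> m j = m' j) ->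
  block_start r m k b = block_start r m' k b.
Proof.
move=> mm'; apply: eq_position => j jb; rewrite /cop_moves; congr cop_reply.
apply/(@eq_in_map nat) => i; rewrite mem_iota => /andP[_ ij].
exact: eq_shadow mm' (ltn_trans ij jb).
Qed.

Lemma cop_moves_simulation r m k b : cop_moves simulation r m k b =
  geodesic (g (block_start r m k b.-1)) (g (block_start r m k b)).
Proof.
rewrite /cop_moves /= size_mkseq.
by congr geodesic; congr g; apply: eq_block_start => j jb;
   rewrite nth_mkseq //; apply: leq_trans jb (leq_pred b).
Qed.

Lemma position_simulation r m k b :
  position (cop_start simulation k) (cop_moves simulation r m k) b =
  g (block_start r m k b.-1).
Proof.
elim: b => // b IHb; rewrite positionS IHb cop_moves_simulation.
by have [] := geodesicP (g (block_start r m k b.-1)) (g (block_start r m k b)).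
Qed.

Lemma dist_block_start s r m k b t :
  legal s (cop_start S k) (cop_moves S (f r) (shadow r m) k) -> (t <= T)%N ->
  (dist (position (cop_start S k) (cop_moves S (f r) (shadow r m) k)
           (b * T + t))
        (block_start r m k b) <= s * t)%N.
Proof. by move=> lS tT; rewrite dist_sym dist_position. Qed.

End Strategy.

(** The bounds on [f] and [g] are exactly what the simulation needs: [stretch]
   and [pace] make the simulated robber legal, [cop_speed] the real cops; in
   [catches], [L] accounts for the vertices of the image of the robber's path
   between images of vertices, and [s * T] for the delay of one block. *)
Lemma cops_win_simulation n L (v : X) (w : Y)
    (sigma psi reach radius s r Q : nat)
    (stretch : forall x y : X, adj x y -> (dist (f x) (f y) <= L)%N)
    (pace : (L * psi <= p * T)%N)
    (cop_speed : forall c d : Y,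
      (dist c d <= s * T)%N -> (dist (g c) (g d) <= sigma)%N)
    (catches : forall (x : X) (c : Y),
      (dist (f x) c <= r + L + s * T)%N -> (dist x (g c) <= reach)%N)
    (defends : forall x : X,
      (dist v x <= radius)%N -> (dist w (f x) <= Q)%N) :
  cops_win n w s p r Q -> cops_win n v sigma psi reach radius.
Proof.
case=> S winS; exists (simulation S) => x m legal_m.
have [legalS outcome] := winS _ _ (legal_shadow stretch legal_m pace).
split=> [k b|].
  rewrite position_simulation cop_moves_simulation.
  set c := block_start _ _ _ _ b.-1; set d := block_start _ _ _ _ b.
  have [pgeo _ ->] := geodesicP (g c) (g d); split=> //; apply: cop_speed.
  rewrite /c /d; case: b {c d pgeo} => [|b]; first by rewrite distxx.
  by rewrite /= /block_start mulSnr dist_position.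
case: outcome => [[i [k catch]]|[N away]]; [left|right]; last first.
  exists N => b Nb; apply: contraT; rewrite -has_predC.
  move=> /has_pathP[k _ /=].
  rewrite -leqNgt => /defends.
  have [q <-] := image_path_vertex (position x m b) (m b) k.
  have [t [k' [tT ->]]] := image_vertex_shadow stretch legal_m pace b q.
  have NbT : (N <= b * T + t)%N.
    apply: leq_trans Nb _; apply: leq_trans (leq_addr _ _).
    by rewrite leq_pmulr.
  move: (away _ NbT); rewrite -[all _ _]negbK -has_predC => nohas near.
  case/negP: nohas; apply/has_pathP.
  exists (minn k' (size (shadow x m (b * T + t)))).
    exact: geq_minr.
  by rewrite /= -leqNgt take_min take_size.
(* Whatever the time of the capture within block [b], the simulated robber is
   close to the image of a vertex of the real move [b], and the simulated cop to
   its position at the start of the block.  The image of that position is where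
   the real cop stands during the real move, which is when it makes its catch. *)
pose b := (i %/ T)%N; pose t := (i %% T)%N.
have iE : i = (b * T + t)%N by exact: divn_eq.
have tT : (t < T)%N by rewrite ltn_mod.
suff [q [c [hit lag]]] : exists q c,
    (dist (last (f (position x m b))
             (take q (image_path (position x m b) (m b)))) c <= r)%N
    /\ (dist c (block_start S x m k b) <= s * T)%N.
  have [k' lek' near] := image_path_near stretch q (legal_m b).1.
  exists b, k; right; apply/has_pathP; exists k' => //.
  rewrite position_simulation /=; apply: catches.
  set z := last (f _) _ in hit near.
  have := dist_triangle z (f (last (position x m b) (take k' (m b))))
            (block_start S x m k b).
  by have := dist_triangle c z (block_start S x m k b); lia.
case: catch => /has_pathP[q leq /= hit].
  have [q' E] := shadow_vertex stretch legal_m pace b 0 tT.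
  exists q'; set P := position (cop_start S k) _ i in hit *.
  set mv := cop_moves _ _ _ _ i in hit leq *; exists (last P (take q mv)).
  split; first by move: hit; rewrite -E take0 -iE.
  have [pmv smv] := legalS k i.
  have := dist_on_path q pmv; have := dist_block_start b (legalS k) (ltnW tT).
  rewrite -iE -/P -/mv in smv * => dP dq.
  have := dist_triangle P (last P (take q mv)) (block_start S x m k b).
  rewrite (dist_sym _ P) => tri.
  have : (s * t.+1 <= s * T)%N by rewrite leq_mul2l tT orbT.
  by rewrite mulnSr; lia.
have [q' E] := shadow_vertex stretch legal_m pace b q tT.
move: hit; rewrite iE E => hit; do 2!eexists; split; first exact: hit.
rewrite -/(position (cop_start S k) _ (b * T + t).+1) -addnS.
apply: leq_trans (dist_block_start b (legalS k) tT) _.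
by rewrite leq_mul2l tT orbT.
Qed.

End Simulation.

(** * Quasi-homotheties *)

(** One natural number [C] stands for both constants of a quasi-homothety of
   ratio [h], so that all estimates can be made in [nat]; [kappa] is a
   quasi-inverse of [iota], chosen by surjectivity. *)
Record coarse_homothety (G D : graph) (C h : nat) (iota : D -> G)
    (kappa : G -> D) : Prop := CoarseHomothety {
  dist_kappaK : forall x, (dist (iota (kappa x)) x <= 2 * C * h)%N;
  dist_iota_le : forall x y,
    (dist (iota x) (iota y) <= h * C * (dist x y).+1)%N;
  le_dist_iota : forall x y,
    (h * dist x y <= C * dist (iota x) (iota y) + C * C * h)%N }.

Lemma surjective_quasi_homotheties_coarse (R : realType) (A B : R)
    (rho : nat -> nat) (Gamma Delta : graph) (iota : nat -> Delta -> Gamma) :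
  1 <= A -> 0 <= B -> (forall j, (0 < rho j)%N) ->
  @surjective_quasi_homotheties R A B rho Gamma (fun=> Delta) iota ->
  exists C, (0 < C)%N /\
    forall j, exists kappa, coarse_homothety C (rho j) (iota j) kappa.
Proof.
move=> hA hB rho_gt0 hiota.
have A_gt0 : 0 < A by lra.
have Cub : A + B <= (Num.bound (A + B))%:R.
  by apply: ltW; apply: archi_boundP; lra.
set C := Num.bound _ in Cub; exists C; split.
  by rewrite -(ltr_nat R); apply: lt_le_trans Cub; lra.
move=> j; have [sur qh] := hiota j; have [kappa Hk] := choice sur.
have h1 : 1 <= (rho j)%:R :> R by rewrite ler1n.
have h0 : 0 < (rho j)%:R :> R by lra.
exists kappa; split=> [x|x y|x y].
- rewrite -(ler_nat R) !natrM; apply: le_trans (Hk x) _; nra.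
- have /andP[_] := qh x y; rewrite ler_pdivrMl // -(ler_nat R) !natrM => hi.
  apply: le_trans hi _; rewrite -mulrA ler_wpM2l ?ltW // -natr1.
  by have := ler0n R (dist x y); nra.
have /andP[+ _] := qh x y; rewrite -(ler_nat R) natrD !natrM.
set d := (dist x y)%:R; set e := (dist _ _)%:R => lo.
have e0 : 0 <= e by rewrite /e ler0n.
have CA : A <= C%:R by lra.
have CB : B <= C%:R by lra.
have AB : A * B <= C%:R * C%:R by apply: ler_pM => //; lra.
have : d <= A * ((rho j)%:R^-1 * e + B) by rewrite -ler_pdivrMl //; lra.
move=> /(ler_wpM2l (ltW h0)) le_d; apply: le_trans le_d _.
have -> : (rho j)%:R * (A * ((rho j)%:R^-1 * e + B)) =
          A * e + A * B * (rho j)%:R.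
  rewrite mulrCA mulrDr mulVKf ?gt_eqF // mulrDr; congr (_ + _).
  by rewrite mulrCA mulrC.
by apply: lerD; rewrite ler_wpM2r // ltW.
Qed.

Section Coarse.
Context {G D : graph} (C h : nat) (iota : D -> G) (kappa : G -> D).
Hypotheses (C_gt0 : (0 < C)%N) (h_gt0 : (0 < h)%N).
Hypothesis ch : coarse_homothety C h iota kappa.

Lemma le_dist_kappa x y :
  (h * dist (kappa x) (kappa y) <= 5 * (C * C) * h + C * dist x y)%N.
Proof.
apply: leq_trans (le_dist_iota ch _ _) _.
have /(leq_mul (leqnn C)) : (dist (iota (kappa x)) (iota (kappa y)) <=
    2 * C * h + (dist x y + 2 * C * h))%N.
  have := dist_triangle x (iota (kappa x)) (iota (kappa y)).
  have := dist_triangle y x (iota (kappa y)); rewrite (dist_sym y).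
  have := dist_kappaK ch x; have := dist_kappaK ch y; lia.
nia.
Qed.

(** At scale [h], distances in [G] are measured in multiples of [h]: the bounds
   below depend on this multiple [t] and on [C], but not on [h]. *)
Lemma dist_kappa_scaled x y t : (dist x y <= t * h)%N ->
  (dist (kappa x) (kappa y) <= 5 * (C * C) + C * t)%N.
Proof.
by move=> xy; rewrite -(leq_pmul2l h_gt0); have := le_dist_kappa x y; nia.
Qed.

Lemma dist_kappa_iota_scaled x c t : (dist (iota x) c <= t * h)%N ->
  (dist x (kappa c) <= C * (t + 2 * C) + C * C)%N.
Proof.
move=> xc; rewrite -(leq_pmul2l h_gt0).
apply: leq_trans (le_dist_iota ch _ _) _.
have /(leq_mul (leqnn C)) :
    (dist (iota x) (iota (kappa c)) <= t * h + 2 * C * h)%N.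
  have := dist_triangle c (iota x) (iota (kappa c)); rewrite (dist_sym c).
  have := dist_kappaK ch c; lia.
nia.
Qed.

Lemma dist_kappa_iota_le x c :
  (dist x (iota c) <= 2 * C * h + h * C * (dist (kappa x) c).+1)%N.
Proof.
apply: leq_trans (dist_triangle (iota (kappa x)) _ _) _.
by rewrite leq_add ?(dist_iota_le ch) // dist_sym (dist_kappaK ch).
Qed.

Lemma weak_to_strong n : weak_cops_win D n -> strong_cops_win G n.
Proof.
move=> winD v; have [s [s_gt0 [r [r_gt0 win]]]] := winD (kappa v).
pose L := (5 * (C * C) + C)%N.
exists (h * C * s.+1)%N; split; first by rewrite !muln_gt0 h_gt0 C_gt0.
move=> psi psi_gt0; exists (2 * C * h + h * C * (r + L + s).+1)%N.
split; first by rewrite addn_gt0 !muln_gt0 h_gt0 C_gt0.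
move=> radius radius_gt0.
have Lpsi_gt0 : (0 < L * psi)%N by rewrite muln_gt0 psi_gt0 /L; lia.
apply: (@cops_win_simulation _ _ kappa iota 1 (L * psi) isT Lpsi_gt0 n L
  v (kappa v) _ _ _ _ s r (5 * (C * C) + C * radius)%N).
- move=> x y /dist_adj xy; rewrite /L -[X in (_ + X)%N]muln1.
  by apply: dist_kappa_scaled; lia.
- by rewrite muln1.
- move=> c d; rewrite muln1 => cd; apply: leq_trans (dist_iota_le ch c d) _.
  by rewrite leq_mul2l ltnS cd orbT.
- move=> x c; rewrite muln1 => xc; apply: leq_trans (dist_kappa_iota_le x c) _.
  by rewrite leq_add2l leq_mul2l ltnS xc orbT.
- move=> x vx; apply: dist_kappa_scaled; apply: leq_trans vx _.
  exact: leq_pmulr.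
by apply: win => //; rewrite addn_gt0 !muln_gt0 C_gt0.
Qed.

(** The speed and reach of the cops on [D] do not involve [h]: they are fixed
   by the constants and by the speed [s] of the cops on [G].  The hypothesis
   [r <= h] is where a large scale is needed. *)
Lemma cops_win_rescaled n (v : D) (w : G) (s psi r radius : nat) :
  (0 < psi)%N -> (0 < radius)%N -> (r <= h)%N ->
  (forall Q, (0 < Q)%N -> cops_win n w s (2 * C * psi) r Q) ->
  cops_win n v (5 * (C * C) + C * s) psi
    (C * (1 + 2 * C + s + 2 * C) + C * C) radius.
Proof.
move=> psi_gt0 radius_gt0 rh win.
have p_gt0 : (0 < 2 * C * psi)%N by rewrite !muln_gt0 C_gt0.
apply: (@cops_win_simulation _ _ iota kappa h (2 * C * psi) h_gt0 p_gt0 n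
  (2 * C * h)%N v w _ _ _ _ s r (dist w (iota v) + h * C * radius.+1)%N).
- move=> x y /dist_adj xy; apply: leq_trans (dist_iota_le ch x y) _; nia.
- by rewrite mulnAC.
- by move=> c d; apply: dist_kappa_scaled.
- by move=> x c xc; apply: dist_kappa_iota_scaled; nia.
- move=> x vx; apply: leq_trans (dist_triangle (iota v) _ _) _.
  rewrite leq_add2l; apply: leq_trans (dist_iota_le ch v x) _.
  by rewrite leq_mul2l ltnS vx orbT.
by apply: win; rewrite addn_gt0 !muln_gt0 h_gt0 C_gt0 orbT.
Qed.

End Coarse.

Lemma strong_to_weak (G D : graph) (C : nat) (rho : nat -> nat)
    (iota : nat -> D -> G) n :
  (0 < C)%N -> (forall j, (0 < rho j)%N) ->
  (forall r, exists j, (r <= rho j)%N) ->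
  (forall j, exists kappa, coarse_homothety C (rho j) (iota j) kappa) ->
  strong_cops_win G n -> weak_cops_win D n.
Proof.
move=> C_gt0 rho_gt0 unbounded ch winG v.
(* The base point of [G] must be chosen before the scale, hence the index 0. *)
have [s [s_gt0 win]] := winG (iota 0%N v).
exists (5 * (C * C) + C * s)%N.
split; first by rewrite addn_gt0 !muln_gt0 C_gt0.
exists (C * (1 + 2 * C + s + 2 * C) + C * C)%N.
split; first by rewrite addn_gt0 !muln_gt0 C_gt0 orbT.
move=> psi psi_gt0.
have p_gt0 : (0 < 2 * C * psi)%N by rewrite !muln_gt0 C_gt0.
have [r [r_gt0 winr]] := win _ p_gt0.
have [j rj] := unbounded r; have [kappa chj] := ch j.
move=> radius radius_gt0.
exact: (cops_win_rescaled C_gt0 (rho_gt0 j) chj v psi_gt0 radius_gt0 rj winr).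
Qed.

Theorem theorem1p7 (R : realType) (Gamma Delta : graph) (A B : R)
    (rho : nat -> nat) (iota : nat -> Delta -> Gamma)
    (hA : 1 <= A) (hB : 0 <= B)
    (rho_gt0 : forall j, (0 < rho j)%N)
    (rho_oo : rho @ \oo --> \oo)
    (hiota : @surjective_quasi_homotheties R A B rho Gamma (fun=> Delta) iota) :
  sCop R Gamma = wCop R Delta.
Proof.
have [C [C_gt0 ch]] :=
  surjective_quasi_homotheties_coarse hA hB rho_gt0 hiota.
have unbounded r : exists j, (r <= rho j)%N.
  by have [N _ /(_ N (leqnn N)) rN] := rho_oo _ (nbhs_infty_ge r); exists N.
rewrite /sCop /wCop; congr (ereal_inf (_ @` _)).
apply/seteqP; split=> n [n_gt0 win]; split=> //.
  exact: strong_to_weak C_gt0 rho_gt0 unbounded ch win.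
have [kappa ch0] := ch 0%N; exact: (weak_to_strong C_gt0 (rho_gt0 0%N) ch0 win).
Qed.
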